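(* Let $A\in\mathbb{R}^{n\times n}$ be symmetric positive definite, let $\tilde P=[\tilde p_1,\dots,\tilde p_s]\in\mathbb{R}^{n\times s}$ have columns normalized so that $\tilde p_j^T A\tilde p_j=1$ for $j=1,\dots,s$, and let $r\in\mathbb{R}^n$. Put $G=\tilde P^T A\tilde P$. Then one Forward Gauss--Seidel (FGS) sweep on the system $G\alpha=\tilde P^T A r$ with initial guess $\alpha^{(0)}=0$ is algebraically equivalent (that is, in exact arithmetic) to one step of Modified Gram--Schmidt (MGS) orthogonalization of $r$ against the columns of $\tilde P$ in the $A$-inner product: if $\alpha^{(1)}=(\alpha^{(1)}_1,\dots,\alpha^{(1)}_s)^T$ is the result of the FGS sweep and $\gamma_1,\dots,\gamma_s$ are the MGS coefficients, then $\alpha^{(1)}_j=\gamma_j$ for all $j=1,\dots,s$.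
   Context: Since $\mathrm{diag}(G)=I$, write $G=I+L+L^T$ with $L$ strictly lower triangular. The FGS iteration for $G\alpha=b$ is $(I+L)\alpha^{(\ell+1)}=b-L^T\alpha^{(\ell)}$; one sweep with $\alpha^{(0)}=0$ yields $\alpha^{(1)}$ with $(I+L)\alpha^{(1)}=b$. Here $b=\tilde P^T A r$. One step of MGS orthogonalization of $r$ against $\tilde p_1,\dots,\tilde p_s$ in the $A$-inner product (the bilinear form $(u,v)\mapsto u^T A v$) is: $w_0=r$ and, for $j=1,\dots,s$, $\gamma_j=w_{j-1}^T A\tilde p_j$, $w_j=w_{j-1}-\gamma_j\tilde p_j$. *)

(* Defs.v *)
From mathcomp Require Import all_boot all_order all_algebra.
From mathcomp Require Import reals.

Set Implicit Arguments.
Unset Strict Implicit.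
Unset Printing Implicit Defensive.

Import Order.TTheory GRing.Theory Num.Theory.
Local Open Scope ring_scope.

Definition ainner (R : realType) (n : nat) (A : 'M[R]_n) (u v : 'cV[R]_n) : R :=
  (u^T *m A *m v) 0 0.

Definition spdmx (R : realType) (n : nat) (A : 'M[R]_n) : Prop :=
  A \is symmetricmx /\ forall x : 'cV[R]_n, x != 0 -> 0 < ainner A x x.

Definition slowmx (R : realType) (s : nat) (G : 'M[R]_s) : 'M[R]_s :=
  \matrix_(i, j) (if (j < i)%N then G i j else 0).

(* The splitting used by [fgs_sweep] below: it is the splitting of [G] only
   because [G] is symmetric with unit diagonal. *)
Lemma slowmx_split (R : realType) (s : nat) (G : 'M[R]_s) :
  G^T = G -> (forall i, G i i = 1) -> G = 1%:M + slowmx G + (slowmx G)^T.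
Proof.
move=> Gsym Gdiag; apply/matrixP => i j; rewrite !mxE.
case: (ltngtP i j) => [ij|ij|/val_inj <-].
- by rewrite -val_eqE /= (ltn_eqF ij) !add0r -[in LHS]Gsym mxE.
- by rewrite -val_eqE /= (gtn_eqF ij) add0r addr0.
- by rewrite eqxx !addr0 Gdiag.
Qed.

(* One forward Gauss-Seidel sweep for G alpha = b, for G = I + L + L^T: the
   solution y of (I + L) y = b - L^T x, where x is the current iterate. *)
Definition fgs_sweep (R : realType) (s : nat) (G : 'M[R]_s) (b x : 'cV[R]_s) :
    'cV[R]_s :=
  invmx (1%:M + slowmx G) *m (b - (slowmx G)^T *m x).

(* [invmx] is a genuine inverse in [fgs_sweep]. *)
Lemma slowmx1_unit (R : realType) (s : nat) (G : 'M[R]_s) :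
  1%:M + slowmx G \in unitmx.
Proof.
have T : is_trig_mx (1%:M + slowmx G).
  apply/is_trig_mxP => i j ij.
  by rewrite !mxE -val_eqE /= (ltn_eqF ij) ltnNge (ltnW ij) addr0.
rewrite unitmxE (det_trig T) big1 ?unitr1 // => i _.
by rewrite !mxE eqxx ltnn addr0.
Qed.

Lemma fgs_sweepP (R : realType) (s : nat) (G : 'M[R]_s) (b x y : 'cV[R]_s) :
  (1%:M + slowmx G) *m y = b - (slowmx G)^T *m x <-> y = fgs_sweep G b x.
Proof.
rewrite /fgs_sweep; split=> [<-|->]; first by rewrite mulKmx ?slowmx1_unit.
by rewrite mulKVmx ?slowmx1_unit.
Qed.

(* Columns are indexed from 0: the column p_j (1 <= j <= s) is [col (j - 1) P],
   so [mgs_residual A P r k] is w_k for k <= s (and w_s for k > s), and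
   [mgs_coef A P r i] is gamma_(i + 1) = w_i^T A p_(i + 1). *)
Fixpoint mgs_residual (R : realType) (n s : nat) (A : 'M[R]_n)
    (P : 'M[R]_(n, s)) (r : 'cV[R]_n) (k : nat) : 'cV[R]_n :=
  if k is k'.+1 then
    let w := mgs_residual A P r k' in
    if insub k' is Some j then w - ainner A w (col j P) *: col j P else w
  else r.

Definition mgs_coef (R : realType) (n s : nat) (A : 'M[R]_n)
    (P : 'M[R]_(n, s)) (r : 'cV[R]_n) (j : 'I_s) : R :=
  ainner A (mgs_residual A P r j) (col j P).

Lemma mgs_residualS (R : realType) (n s : nat) (A : 'M[R]_n)
    (P : 'M[R]_(n, s)) (r : 'cV[R]_n) (j : 'I_s) :
  mgs_residual A P r j.+1 =
    mgs_residual A P r j - mgs_coef A P r j *: col j P.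
Proof. by rewrite /= valK. Qed.

(* Main.v *)
(* Unrolling the MGS recursion, w_j = r - \sum_(i < j) gamma_i p_i, so that
   gamma_j = (r, p_j)_A - \sum_(i < j) gamma_i (p_i, p_j)_A. By symmetry of A
   this is the j-th row of (I + L) gamma = P^T A r, the triangular system
   solved by the sweep from 0. *)
Require Import Defs.
From mathcomp Require Import all_boot all_order all_algebra.
From mathcomp Require Import reals.
Import Order.TTheory GRing.Theory Num.Theory.
Local Open Scope ring_scope.

(** A 1-by-1 matrix is its own transpose, and transposing turns u^T A v into v^T A^T u. *)
Lemma ainnerC (R : realType) (n : nat) (A : 'M[R]_n) (u v : 'cV[R]_n) :
  A^T = A -> ainner A u v = ainner A v u.
Proof.
move=> Asym; rewrite /ainner -[in LHS](trmxK (u^T *m A *m v)) mxE.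
by rewrite !trmx_mul trmxK Asym mulmxA.
Qed.

Lemma ainnerBl (R : realType) (n : nat) (A : 'M[R]_n) (u v w : 'cV[R]_n) :
  ainner A (u - v) w = ainner A u w - ainner A v w.
Proof. by rewrite /ainner linearB /= !mulmxBl !mxE. Qed.

Lemma ainnerZl (R : realType) (n : nat) (A : 'M[R]_n) (a : R)
    (u v : 'cV[R]_n) :
  ainner A (a *: u) v = a * ainner A u v.
Proof. by rewrite /ainner linearZ /= -!scalemxAl mxE. Qed.

Lemma ainner_suml (R : realType) (n : nat) (A : 'M[R]_n) (I : finType)
    (Q : pred I) (F : I -> 'cV[R]_n) (v : 'cV[R]_n) :
  ainner A (\sum_(i | Q i) F i) v = \sum_(i | Q i) ainner A (F i) v.
Proof. by rewrite /ainner linear_sum /= !mulmx_suml summxE. Qed.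

(** With [Q = P] this reads off the entries of G; with [Q = r], a one-column matrix, those of the
    right-hand side. *)
Lemma mulmx_ainner (R : realType) (n s t : nat) (A : 'M[R]_n)
    (P : 'M[R]_(n, s)) (Q : 'M[R]_(n, t)) (i : 'I_s) (j : 'I_t) :
  (P^T *m A *m Q) i j = ainner A (col i P) (col j Q).
Proof.
rewrite /ainner tr_col -row_mul [LHS]mxE [RHS]mxE.
by apply: eq_bigr => k _; rewrite [row _ _ _ _]mxE [col _ _ _ _]mxE.
Qed.

Lemma mgs_residual_sum (R : realType) (n s : nat) (A : 'M[R]_n)
    (P : 'M[R]_(n, s)) (r : 'cV[R]_n) (k : nat) :
  (k <= s)%N ->
  mgs_residual A P r k =
    r - \sum_(i < s | (i < k)%N) mgs_coef A P r i *: col i P.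
Proof.
elim: k => [|k IHk] ks; first by rewrite big_pred0 ?subr0.
(* [ks] also says [k < s], so [k] is a genuine column index and the recursion does subtract a term
   here. *)
rewrite (mgs_residualS A P r (Ordinal ks)) /= IHk 1?ltnW //.
rewrite -addrA -opprD [in RHS](bigD1 (Ordinal ks)) //= [in RHS]addrC.
congr (_ - (_ + _)).
by apply: eq_bigl => i; rewrite -val_eqE /= ltnS ltn_neqAle andbC.
Qed.

Lemma mgs_coef_sum (R : realType) (n s : nat) (A : 'M[R]_n)
    (P : 'M[R]_(n, s)) (r : 'cV[R]_n) (j : 'I_s) :
  mgs_coef A P r j = ainner A r (col j P) -
    \sum_(i < s | (i < j)%N)
      mgs_coef A P r i * ainner A (col i P) (col j P).
Proof.
rewrite {1}/mgs_coef mgs_residual_sum 1?ltnW // ainnerBl ainner_suml.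
by congr (_ - _); apply: eq_bigr => i _; rewrite ainnerZl.
Qed.

Theorem theorem3 (R : realType) (n s : nat) (A : 'M[R]_n) (P : 'M[R]_(n, s))
    (r : 'cV[R]_n) (hA : spdmx A)
    (hP : forall j : 'I_s, ainner A (col j P) (col j P) = 1) :
  forall j : 'I_s,
    fgs_sweep (P^T *m A *m P) (P^T *m A *m r) 0 j 0 = mgs_coef A P r j.
Proof.
have Asym : A^T = A.
  (* [symmetricmx] is the Hermitian predicate with sign (-1)^0 and the identity as conjugation. *)
  by case: hA => /eqP; rewrite expr0 scale1r map_mx_id.
pose y : 'cV[R]_s := \col_j mgs_coef A P r j.
(* The triangular system has a unique solution, so it is enough that the MGS coefficients solve
   it. *)
suff /fgs_sweepP <- : (1%:M + slowmx (P^T *m A *m P)) *m y =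
    P^T *m A *m r - (slowmx (P^T *m A *m P))^T *m 0 by move=> j; rewrite mxE.
have col0r : col 0 r = r by apply/colP => i; rewrite mxE.
apply/colP => j; rewrite mulmx0 subr0 mulmxDl mul1mx mulmx_ainner col0r.
rewrite (ainnerC _ _ _ _ _ Asym) [LHS]mxE [y j 0]mxE mgs_coef_sum.
(* Cancelling (r, p_j)_A leaves (L y)_j = \sum_(i < j) gamma_i (p_i, p_j)_A. *)
apply/eqP; rewrite -addrA addrC -subr_eq0 addrK addrC subr_eq0; apply/eqP.
(* Row j of L vanishes from the diagonal on, which matches the condition i < j; below it, G_ji =
   (p_j, p_i)_A is flipped by symmetry of [A]. *)
rewrite mxE [RHS]big_mkcond; apply: eq_bigr => i _.
rewrite mxE [y i 0]mxE mulmx_ainner (ainnerC _ _ _ _ _ Asym) mulrC.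
by case: ifP => // _; rewrite mulr0.
Qed.
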